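(* There is a computable graph $\mathcal{G}$ such that for every cohesive set $C \subseteq \mathbb{N}$, every presentation of the cohesive power $\prod_C \mathcal{G}$ computes $0''$.
   Context: $0''$ denotes the double Turing jump of the empty set. Graphs are simple graphs, viewed as structures in the language with one binary relation symbol (the edge relation, symmetric and irreflexive). Presentations: A presentation (or copy) of a countable structure $\mathcal{M}$ is an isomorphic copy of $\mathcal{M}$ whose domain is a non-empty subset of $\mathbb{N}$. A structure with domain contained in $\mathbb{N}$ is identified with the subset of $\mathbb{N}$ encoding (as an effective join) its domain and its relations; computability-theoretic terms (computable, computes) applied to such a structure refer to this set. Cohesive sets: $X \subseteq^* Y$ means $X \setminus Y$ is finite. A set $C \subseteq \mathbb{N}$ is cohesive if it is infinite and for every computably enumerable set $W$, either $C \subseteq^* W$ or $C \subseteq^* \mathbb{N} \setminus W$. Cohesive power: Let $\mathcal{G}$ be a computable graph with domain $|\mathcal{G}|$ and edge relation $E$, and let $C$ be cohesive. Let $D$ be the set of partial computable functions $\varphi : \mathbb{N} \to \mathbb{N}$ such that $\varphi(n) \in |\mathcal{G}|$ whenever $\varphi(n)$ is defined, and $C \subseteq^* \mathrm{dom}(\varphi)$. For $\varphi, \psi \in D$ let $\varphi =_C \psi$ mean $C \subseteq^* \{n : \varphi(n) \text{ and } \psi(n) \text{ are defined and equal}\}$; this is an equivalence relation, and $[\varphi]$ denotes the class of $\varphi$. The cohesive power $\prod_C \mathcal{G}$ has domain $\{[\varphi] : \varphi \in D\}$, with an edge between $[\varphi]$ and $[\psi]$ iff $C \subseteq^* \{n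 : \varphi(n), \psi(n) \text{ are defined and } E(\varphi(n), \psi(n))\}$. It is again a graph. *)

(* Defs.v *)
From Stdlib Require Cantor.
From mathcomp Require Import all_boot zify.
From mathcomp Require Import mathcomp_extra boolp classical_sets functions.
From mathcomp Require Import cardinality.

Set Implicit Arguments.
Unset Strict Implicit.
Unset Printing Implicit Defensive.

Local Open Scope classical_set_scope.

(** * Oracle computability *)

(* Kleene's partial recursive functions, relativized to an oracle; all
   functions are unary, several arguments being passed as one Cantor pair. *)
Inductive code : Type :=
| CZero | CSucc | CFst | CSnd | COracle
| CPair of code & code
| CComp of code & code
| CPrec of code & code
| CMin of code.

Definition pr (a b : nat) : nat := Cantor.to_nat (a, b).
Definition pr1 (n : nat) : nat := fst (Cantor.of_nat n).
Definition pr2 (n : nat) : nat := snd (Cantor.of_nat n).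

(* [eval X c n m]: program [c] with oracle [X] halts on input [n] with output
   [m].  [CPrec f g] is primitive recursion on the second component of the
   input; [CMin f] is unbounded search, where [f] must be defined (and nonzero)
   at every argument before the one returned. *)
Fixpoint eval (X : set nat) (c : code) (n m : nat) {struct c} : Prop :=
  match c with
  | CZero => m = 0
  | CSucc => m = n.+1
  | CFst => m = pr1 n
  | CSnd => m = pr2 n
  | COracle => (X n /\ m = 1) \/ (~ X n /\ m = 0)
  | CPair f g => exists a b, [/\ eval X f n a, eval X g n b & m = pr a b]
  | CComp f g => exists2 k, eval X g n k & eval X f k m
  | CPrec f g =>
      (fix iterate (k v : nat) {struct k} : Prop :=
         match k with
         | 0 => eval X f (pr1 n) v
         | k'.+1 => exists2 u, iterate k' u
                              & eval X g (pr (pr1 n) (pr k' u)) v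
         end) (pr2 n) m
  | CMin f => eval X f (pr n m) 0 /\
      forall k, k < m -> exists v, eval X f (pr n k) v.+1
  end.

Definition halts (X : set nat) (c : code) (n : nat) : Prop :=
  exists m, eval X c n m.

(* A Goedel numbering: a bijection between programs and natural numbers
   (see [encode_inj] and [encode_surj]). *)
Fixpoint encode (c : code) : nat :=
  match c with
  | CZero => 0
  | CSucc => 1
  | CFst => 2
  | CSnd => 3
  | COracle => 4
  | CPair f g => 4 * pr (encode f) (encode g) + 5
  | CComp f g => 4 * pr (encode f) (encode g) + 6
  | CPrec f g => 4 * pr (encode f) (encode g) + 7
  | CMin f => 4 * encode f + 8
  end.

Lemma pr_inj a b a' b' : pr a b = pr a' b' -> a = a' /\ b = b'.
Proof. by move/Cantor.to_nat_inj => [-> ->]. Qed.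

Lemma encode_inj : injective encode.
Proof.
have codeP f g f' g' : encode f = encode f' -> encode g = encode g' ->
  (forall d, encode f = encode d -> f = d) ->
  (forall d, encode g = encode d -> g = d) -> f = f' /\ g = g'.
  by move=> ef eg hf hg; split; [exact: hf | exact: hg].
by elim=> [||||| f hf g hg| f hf g hg| f hf g hg| f hf]
  [||||| f' g'| f' g'| f' g'| f'] //= e; try lia;
  try (have /pr_inj[ef eg] : pr (encode f) (encode g) =
                             pr (encode f') (encode g') by lia);
  try (by have [-> ->] := codeP _ _ _ _ ef eg hf hg);
  rewrite (hf f') //; lia.
Qed.

Lemma prK n : pr (pr1 n) (pr2 n) = n.
Proof. by rewrite /pr /pr1 /pr2 -surjective_pairing Cantor.cancel_to_of. Qed.

Lemma encode_surj n : exists c, encode c = n.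
Proof.
have [k] := ubnP n; elim: k n => // k IH n nk.
have [n5|n5] := ltnP n 5.
  case: n n5 {nk} => [|[|[|[|[|//]]]]] _.
  - by exists CZero.
  - by exists CSucc.
  - by exists CFst.
  - by exists CSnd.
  - by exists COracle.
pose q := (n - 5) %/ 4.
have hq : n = 4 * q + 5 + (n - 5) %% 4 by rewrite /q; lia.
have le12 : pr1 q <= q /\ pr2 q <= q.
  have := Cantor.to_nat_non_decreasing (pr1 q) (pr2 q).
  by rewrite -/(pr _ _) prK; lia.
have [f hf] : exists c, encode c = pr1 q by apply: IH; lia.
have [g hg] : exists c, encode c = pr2 q by apply: IH; lia.
have [h hh] : exists c, encode c = q by apply: IH; lia.
have : (n - 5) %% 4 < 4 by rewrite ltn_mod.
case E : ((n - 5) %% 4) => [|[|[|[|//]]]] _.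
- by exists (CPair f g) => /=; rewrite hf hg prK; lia.
- by exists (CComp f g) => /=; rewrite hf hg prK; lia.
- by exists (CPrec f g) => /=; rewrite hf hg prK; lia.
- by exists (CMin h) => /=; rewrite hh; lia.
Qed.

Definition computes (X Y : set nat) : Prop :=
  exists c : code, forall n,
    (Y n -> eval X c n 1) /\ (~ Y n -> eval X c n 0).

Definition computable (Y : set nat) : Prop := computes set0 Y.

Definition ce (W : set nat) : Prop :=
  exists c : code, W = [set n | halts set0 c n].

Definition jump (X : set nat) : set nat :=
  [set e | exists2 c, encode c = e & halts X c e].

Definition pfun : Type := nat -> option nat.

Definition pcomputable (phi : pfun) : Prop :=
  exists c : code, forall n m, phi n = Some m <-> eval set0 c n m.

(** * Graphs and their presentations *)

Record graph (T : Type) : Type := Graph {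
  vert : set T;
  edge : T -> T -> Prop;
  vert_nonempty : vert !=set0;
  edge_vert : forall x y, edge x y -> vert x /\ vert y;
  edge_sym : forall x y, edge x y -> edge y x;
  edge_irrefl : forall x, ~ edge x x
}.

Definition isomorphic (T U : Type) (A : graph T) (B : graph U) : Prop :=
  exists f : T -> U, set_bij (vert A) (vert B) f /\
    forall x y, vert A x -> vert A y -> (edge A x y <-> edge B (f x) (f y)).

(* The effective join of the domain and of the edge relation. *)
Definition diagram (A : graph nat) : set nat :=
  [set 2 * x | x in vert A] `|`
  [set n | exists x y, edge A x y /\ n = 2 * pr x y + 1].

Definition presentation (T : Type) (B : graph T) (A : graph nat) : Prop :=
  isomorphic A B.

(** * Cohesive powers *)

Definition almost_subset (X Y : set nat) : Prop := finite_set (X `\` Y).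
Notation "X `<=*` Y" := (almost_subset X Y) (at level 70, no associativity).

Definition cohesive (C : set nat) : Prop :=
  infinite_set C /\ forall W, ce W -> C `<=*` W \/ C `<=*` ~` W.

Section CohesivePower.
Variables (G : graph nat) (C : set nat).

Definition power_fun (phi : pfun) : Prop :=
  [/\ pcomputable phi,
      forall n x, phi n = Some x -> vert G x
    & C `<=*` [set n | exists x, phi n = Some x]].

Definition eqC (phi psi : pfun) : Prop :=
  C `<=*` [set n | exists x, phi n = Some x /\ psi n = Some x].

Definition edgeC (phi psi : pfun) : Prop :=
  C `<=*` [set n | exists x y,
                     [/\ phi n = Some x, psi n = Some y & edge G x y]].

Definition power_class (phi : pfun) : set pfun :=
  [set psi | power_fun psi /\ eqC phi psi].

Definition power_vert : set (set pfun) :=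
  [set power_class phi | phi in [set phi | power_fun phi]].

(* Independent of the representatives, see [power_edgeE]. *)
Definition power_edge (K L : set pfun) : Prop :=
  exists phi psi, [/\ power_fun phi, power_fun psi,
    K = power_class phi, L = power_class psi & edgeC phi psi].

Lemma almost_sub3 (X Y Z : set nat) :
  C `<=*` X -> C `<=*` Y -> (X `&` Y `<=` Z) -> C `<=*` Z.
Proof.
rewrite /almost_subset => hX hY sZ.
have hU : finite_set ((C `\` X) `|` (C `\` Y)) by rewrite finite_setU.
apply: sub_finite_set hU => n [Cn nZ].
have [Xn|nX] := pselect (X n); last by left.
by right; split => // Yn; apply: nZ; apply: sZ.
Qed.

Lemma eqC_refl phi : power_fun phi -> eqC phi phi.
Proof.
by move=> [_ _ h]; apply: (almost_sub3 h h) => n /= [[x ->] _]; exists x.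
Qed.

Lemma eqC_sym phi psi : eqC phi psi -> eqC psi phi.
Proof. by move=> h; apply: (almost_sub3 h h) => n /= [[x []]]; exists x. Qed.

Lemma eqC_trans phi psi chi : eqC phi psi -> eqC psi chi -> eqC phi chi.
Proof.
move=> h h'; apply: (almost_sub3 h h') => n /= [[x [px qx]] [y [qy ry]]].
by exists x; split=> //; rewrite ry -qy.
Qed.

Lemma power_class_eq phi psi : power_fun psi ->
  power_class phi = power_class psi <-> eqC phi psi.
Proof.
move=> Dpsi; split => [e|e].
  by have [] : power_class phi psi by rewrite e; split=> //; apply: eqC_refl.
apply/seteqP; split => chi [Dchi h]; split=> //.
  exact: eqC_trans (eqC_sym e) h.
exact: eqC_trans e h.
Qed.

Lemma edgeC_eqC phi psi phi' psi' :
  eqC phi phi' -> eqC psi psi' -> edgeC phi psi -> edgeC phi' psi'.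
Proof.
move=> h h' e; have := almost_sub3 h h' (@subset_refl _ _).
move=> /almost_sub3 /(_ e); apply=> n.
move=> [] [] [x [px p'x]] [y [qy q'y]] [x2 [y2 [px2 qy2 xy]]] /=.
by exists x2, y2; split=> //; rewrite ?p'x ?q'y -?px -?qy.
Qed.

Lemma power_edgeE phi psi : power_fun phi -> power_fun psi ->
  power_edge (power_class phi) (power_class psi) <-> edgeC phi psi.
Proof.
move=> Dphi Dpsi; split; last by exists phi, psi.
move=> [phi' [psi' [D1 D2 /power_class_eq e1 /power_class_eq e2 e]]].
by apply: edgeC_eqC e; apply: eqC_sym; [exact: e1 | exact: e2].
Qed.

Lemma pcomputable_cst (a : nat) : pcomputable (fun=> Some a).
Proof.
have [c hc] : exists c, forall n m, eval set0 c n m <-> m = a.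
  elim: a => [|a [c hc]]; first by exists CZero.
  exists (CComp CSucc c) => n m /=; split => [[k /hc -> //]|->].
  by exists a => //; apply/hc.
by exists c => n m; rewrite hc; split => [[]|->].
Qed.

Lemma power_vert_nonempty : power_vert !=set0.
Proof.
have [a Ga] := vert_nonempty G.
exists (power_class (fun=> Some a)), (fun=> Some a) => //; split.
- exact: pcomputable_cst.
- by move=> n x [<-].
- have -> : [set n : nat | exists x, Some a = Some x] = setT.
    by apply/seteqP; split=> // n _; exists a.
  by rewrite /almost_subset setDT.
Qed.

Lemma power_edge_vert K L : power_edge K L -> power_vert K /\ power_vert L.
Proof.
by move=> [phi [psi [D1 D2 -> -> _]]]; split; [exists phi | exists psi].
Qed.

Lemma power_edge_sym K L : power_edge K L -> power_edge L K.
Proof.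
move=> [phi [psi [D1 D2 -> -> e]]]; exists psi, phi; split=> //.
apply: (almost_sub3 e e) => n /= [[x [y [px qy xy]]] _].
by exists y, x; split=> //; apply: edge_sym.
Qed.

Hypothesis cohC : cohesive C.

Lemma power_edge_irrefl K : ~ power_edge K K.
Proof.
move=> [phi [psi [D1 D2 -> e h]]].
move: e => /(power_class_eq _ D2) e.
case: cohC => infC _; apply: infC; rewrite -[C]setD0.
apply: (almost_sub3 e h) => n /= [[x [px qx]] [x' [y [px' qy]]]].
move: px' qy; rewrite px qx; case=> <-; case=> <- xx.
exact: (edge_irrefl xx).
Qed.

Definition cohesive_power : graph (set pfun) :=
  Graph power_vert_nonempty power_edge_vert power_edge_sym power_edge_irrefl.

End CohesivePower.

(* Main.v *)
Require Import Defs.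
From Stdlib Require Cantor.
From mathcomp Require Import all_boot zify.
From mathcomp Require Import boolp classical_sets functions cardinality.

(** Why the theorem holds.  An existential property of the class of a partial
    computable [phi] in a cohesive power says that the corresponding c.e.
    property of [phi n] holds for almost all [n] in [C].  Constant functions
    therefore reveal only c.e. information about the graph, but a single
    nonstandard element, the class of [n |-> track n], reveals much more.  If
    [W j] are uniformly c.e. initial segments of the natural numbers, each
    finite or everything, and the graph makes [n] in [W j] visible as an
    existential property of [track n], then a presentation enumerates the set
    of all [j] with [W j] infinite: [C] is infinite, so it is almost contained
    in no finite set.  Infinity of [W j] is a Pi_2 property, and every Pi_2
    set arises in this way.

    The set 0'' is Sigma_2: [e] is in 0'' iff [sigma2 e k s] holds for some [k]
    and all [s], with [sigma2] computable ([sigma2P]).  Put [n] in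
    [W (pr e k.+1)] if [sigma2 e k t] holds for all [t < n], and in
    [W (pr e 0)] if each [k < n] has a [t] with [sigma2 e k t] false.  Then [e]
    is in 0'' iff some [W (pr e k.+1)] is infinite, and outside it iff
    [W (pr e 0)] is infinite ([double_jumpP], [double_jumpNP]).  Both 0'' and
    its complement are thus enumerated from the presentation, which knows
    finitely many of its own elements as constants, and Post's theorem
    ([computes_of_enumerations]) concludes.

    In the graph, a vertex [wit j n s] is adjacent to both [ray j] and
    [track n] exactly when [s] witnesses that [n] is in [W j].  A presentation
    must also locate the class of the constant [ray j], uniformly in [j]: the
    vertices [ray 0], [ray 1], ... form a path, and [ray j] is adjacent to
    [hub (j %% 3)].  The residue orients the path, so that [ray j.+1] is the
    only common neighbour of [ray j] and [hub (j.+1 %% 3)]; this uniqueness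
    passes to the power ([next_ray]).

    The computability half rests on [jumpP]: halting with an oracle is the
    existence of a finite set of triples (program, input, output), each
    justified by others in the set according to the last clause of the
    evaluation.  Being such a set is decidable in the oracle, and replacing the
    oracle 0' by its stages gives [sigma2]. *)

Set Implicit Arguments.
Unset Strict Implicit.
Unset Printing Implicit Defensive.

Local Open Scope classical_set_scope.

(** * Pairing and coded sequences *)

Lemma pr1E a b : pr1 (pr a b) = a.
Proof. by rewrite /pr1 /pr Cantor.cancel_of_to. Qed.

Lemma pr2E a b : pr2 (pr a b) = b.
Proof. by rewrite /pr2 /pr Cantor.cancel_of_to. Qed.

Lemma pr_bounds a b : a <= pr a b /\ b <= pr a b.
Proof.
by have := Cantor.to_nat_non_decreasing a b; rewrite -/(pr _ _); lia.
Qed.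

Lemma pr1_le n : pr1 n <= n.
Proof. by rewrite -{2}(prK n); have [] := pr_bounds (pr1 n) (pr2 n). Qed.

Lemma pr2_le n : pr2 n <= n.
Proof. by rewrite -{2}(prK n); have [] := pr_bounds (pr1 n) (pr2 n). Qed.

Lemma pr2_lt n : pr2 n.+1 < n.+1.
Proof.
rewrite ltn_neqAle pr2_le andbT; apply/eqP => e.
have h := prK n.+1; rewrite e in h.
have := Cantor.to_nat_spec (pr1 n.+1) n.+1; rewrite -/(pr _ _) h.
nia.
Qed.

(** A number codes the sequence of its successive first components; after
    finitely many steps, at most [d], all entries are 0. *)
Definition entry (d i : nat) : nat := pr1 (iter i pr2 d).

Definition mem (d t : nat) : Prop := exists i, entry d i = t.

Lemma iter_pr2_0 i d : d <= i -> iter i pr2 d = 0.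
Proof.
elim: i d => [|i IH] [|d] //= h; rewrite -iterS iterSr; apply: IH => //.
by have := pr2_lt d; lia.
Qed.

Lemma memP d t : mem d t <-> exists2 i, i < d.+1 & entry d i = t.
Proof.
split=> [[i <-]|[i _ <-]]; last by exists i.
have [h|h] := ltnP i d; first by exists i => //; lia.
by exists d => //; rewrite /entry !iter_pr2_0.
Qed.

Lemma entry_le d i : entry d i <= d.
Proof.
have h : iter i pr2 d <= d.
  by elim: i => //= i; apply: leq_trans; exact: pr2_le.
exact: leq_trans (pr1_le _) h.
Qed.

Lemma mem_le d t : mem d t -> t <= d.
Proof. by move=> [i <-]; exact: entry_le. Qed.

Lemma entry_foldr s i : entry (foldr pr 0 s) i = nth 0 s i.
Proof.
elim: s i => [|x s IH] i /=; first by rewrite nth_nil /entry iter_pr2_0.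
case: i => [|i]; first by rewrite /entry /= pr1E.
by rewrite -[RHS]IH /entry iterSr pr2E.
Qed.

(** * Total functions and predicates computable in an oracle *)

Definition cfun (X : set nat) (f : nat -> nat) : Prop :=
  exists c, forall n m, eval X c n m <-> m = f n.

Definition cpred (X : set nat) (P : nat -> Prop) : Prop :=
  cfun X (fun n => nat_of_bool `[< P n >]).

Section Closure.
Variable X : set nat.
Implicit Types (f g b : nat -> nat) (P Q : nat -> Prop).

Lemma cfun_ext f g : f =1 g -> cfun X f -> cfun X g.
Proof. by move=> e [c hc]; exists c => n m; rewrite hc e. Qed.

Lemma cfun_id : cfun X (fun x => x).
Proof.
exists (CPair CFst CSnd) => n m /=; split => [[a [b [-> -> ->]]]|->].
  by rewrite prK.
by exists (pr1 n), (pr2 n); rewrite prK.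
Qed.

Lemma cfun_comp f g : cfun X f -> cfun X g -> cfun X (fun x => f (g x)).
Proof.
move=> [c hc] [d hd]; exists (CComp c d) => n m /=.
split=> [[k /hd -> /hc ->] //|->]; exists (g n); [exact/hd | exact/hc].
Qed.

Lemma cfun_succ f : cfun X f -> cfun X (fun x => (f x).+1).
Proof. by apply: (cfun_comp (f := S)); exists CSucc. Qed.

Lemma cfun_pr1 f : cfun X f -> cfun X (fun x => pr1 (f x)).
Proof. by apply: cfun_comp; exists CFst. Qed.

Lemma cfun_pr2 f : cfun X f -> cfun X (fun x => pr2 (f x)).
Proof. by apply: cfun_comp; exists CSnd. Qed.

Lemma cfun_pr f g : cfun X f -> cfun X g -> cfun X (fun x => pr (f x) (g x)).
Proof.
move=> [c hc] [d hd]; exists (CPair c d) => n m /=.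
split=> [[a [b [/hc -> /hd -> ->]]] //|->].
by exists (f n), (g n); split=> //; [apply/hc | apply/hd].
Qed.

Lemma cfun_cst a : cfun X (fun=> a).
Proof.
elim: a => [|a IH]; first by exists CZero.
exact: (cfun_succ IH).
Qed.

Lemma cfun_comp2 (h : nat -> nat -> nat) f g :
  cfun X (fun z => h (pr1 z) (pr2 z)) ->
  cfun X f -> cfun X g -> cfun X (fun x => h (f x) (g x)).
Proof.
move=> hh hf hg; apply: cfun_ext (cfun_comp hh (cfun_pr hf hg)) => x.
by rewrite pr1E pr2E.
Qed.

Lemma cfun_rec f (g : nat -> nat -> nat -> nat) b : cfun X f ->
  cfun X (fun z => g (pr1 z) (pr1 (pr2 z)) (pr2 (pr2 z))) -> cfun X b ->
  cfun X (fun x => nat_rec (fun=> nat) (f x) (g x) (b x)).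
Proof.
move=> [c hc] [d hd].
apply: (cfun_comp2 (h := fun x k => nat_rec (fun=> nat) (f x) (g x) k));
  last exact: cfun_id.
exists (CPrec c d) => n m /=; move: (pr2 n) m; elim=> [|k IH] m //=.
split=> [[u /IH -> /hd ->]|->]; first by rewrite pr1E !pr2E pr1E.
exists (nat_rec (fun=> nat) (f (pr1 n)) (g (pr1 n)) k); first exact/IH.
by apply/hd; rewrite pr1E !pr2E pr1E.
Qed.

Lemma cfun_iter f (g : nat -> nat -> nat) b :
  cfun X (fun z => g (pr1 z) (pr2 z)) -> cfun X b -> cfun X f ->
  cfun X (fun x => iter (b x) (g x) (f x)).
Proof.
move=> hg hb hf.
have hg' := cfun_comp2 hg (cfun_pr1 cfun_id) (cfun_pr2 (cfun_pr2 cfun_id)).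
have := cfun_rec (g := fun x _ u => g x u) hf hg' hb.
by apply: cfun_ext => x; elim: (b x) => //= k ->.
Qed.

Lemma cfun_add f g : cfun X f -> cfun X g -> cfun X (fun x => f x + g x).
Proof.
move=> hf hg.
have := cfun_iter (g := fun _ u => u.+1) (cfun_succ (cfun_pr2 cfun_id)) hg hf.
by apply: cfun_ext => x; elim: (g x) => [|k] /=; lia.
Qed.

Lemma cfun_mulc k f : cfun X f -> cfun X (fun x => k * f x).
Proof.
move=> hf; elim: k => [|k IH].
  exact: cfun_ext (cfun_cst 0).
by apply: cfun_ext (cfun_add hf IH) => x; rewrite mulSn.
Qed.

Lemma cfun_pred f : cfun X f -> cfun X (fun x => (f x).-1).
Proof.
move=> hf.
have := cfun_rec (g := fun _ k _ => k) (cfun_cst 0)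
  (cfun_pr1 (cfun_pr2 cfun_id)) hf.
by apply: cfun_ext => x; case: (f x).
Qed.

Lemma cfun_sub f g : cfun X f -> cfun X g -> cfun X (fun x => f x - g x).
Proof.
move=> hf hg.
have := cfun_iter (g := fun _ u => u.-1) (cfun_pred (cfun_pr2 cfun_id)) hg hf.
by apply: cfun_ext => x; elim: (g x) => [|k] /=; lia.
Qed.

Lemma cfun_entry f g :
  cfun X f -> cfun X g -> cfun X (fun x => entry (f x) (g x)).
Proof.
move=> hf hg; apply: cfun_pr1.
exact: (cfun_iter (g := fun _ u => pr2 u) (cfun_pr2 (cfun_pr2 cfun_id)) hg hf).
Qed.

Lemma cpred_ext P Q : (forall x, P x <-> Q x) -> cpred X P -> cpred X Q.
Proof. by move=> e; apply: cfun_ext => x; rewrite (asbool_equiv_eq (e x)). Qed.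

Lemma cpred_eq0 f : cfun X f -> cpred X (fun x => f x = 0).
Proof.
move=> hf; apply: cfun_ext (cfun_sub (cfun_cst 1) hf) => x.
by case: asboolP => h; lia.
Qed.

Lemma cpred_eq f g : cfun X f -> cfun X g -> cpred X (fun x => f x = g x).
Proof.
move=> hf hg.
have := cpred_eq0 (cfun_add (cfun_sub hf hg) (cfun_sub hg hf)).
by apply: cpred_ext => x; lia.
Qed.

Lemma cpred_lt f g : cfun X f -> cfun X g -> cpred X (fun x => f x < g x).
Proof.
move=> hf hg; have := cpred_eq0 (cfun_sub (cfun_succ hf) hg).
by apply: cpred_ext => x; lia.
Qed.

Lemma cpred_not P : cpred X P -> cpred X (fun x => ~ P x).
Proof.
move=> hP; have := cpred_eq0 hP.
by apply: cpred_ext => x; case: asboolP.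
Qed.

Lemma cpred_and P Q : cpred X P -> cpred X Q -> cpred X (fun x => P x /\ Q x).
Proof.
move=> hP hQ.
have := cpred_eq0 (cfun_add (cpred_not hP) (cpred_not hQ)).
apply: cpred_ext => x; case: asboolP => p; case: asboolP => q; split => //.
- by move=> [].
- by move=> [].
- by move=> [].
- by move=> _; split; apply: contrapT.
Qed.

Lemma cpred_or P Q : cpred X P -> cpred X Q -> cpred X (fun x => P x \/ Q x).
Proof.
move=> hP hQ; have := cpred_not (cpred_and (cpred_not hP) (cpred_not hQ)).
by apply: cpred_ext => x; rewrite not_andP !notK.
Qed.

Lemma cpred_comp P f : cpred X P -> cfun X f -> cpred X (fun x => P (f x)).
Proof. exact: cfun_comp. Qed.

Lemma cpred_comp2 (R : nat -> nat -> Prop) f g :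
  cpred X (fun z => R (pr1 z) (pr2 z)) ->
  cfun X f -> cfun X g -> cpred X (fun x => R (f x) (g x)).
Proof. exact: (@cfun_comp2 (fun x y => `[< R x y >] : nat)). Qed.

Lemma cpred_all (R : nat -> nat -> Prop) b :
  cpred X (fun z => R (pr1 z) (pr2 z)) -> cfun X b ->
  cpred X (fun x => forall k, k < b x -> R x k).
Proof.
move=> hR hb.
pose step x k u := u - `[< ~ R x k >].
have hstep : cfun X (fun z => step (pr1 z) (pr1 (pr2 z)) (pr2 (pr2 z))).
  (* Truncated subtraction: the value drops to 0 at the first failure. *)
  apply: cfun_sub; first exact: cfun_pr2 (cfun_pr2 cfun_id).
  apply: (cpred_comp2 (R := fun x k => ~ R x k)); first exact: cpred_not.
    exact: cfun_pr1 cfun_id.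
  exact: cfun_pr1 (cfun_pr2 cfun_id).
apply: cfun_ext (cfun_rec (cfun_cst 1) hstep hb) => x.
elim: (b x) => [|n IH] /=; first by case: asboolP => // -[].
rewrite IH /step.
case: asboolP => h1; case: asboolP => h2; case: asboolP => h3 //.
- by case: h2; apply: h3.
- case: h3 => k; rewrite ltnS leq_eqVlt => /orP[/eqP ->|]; last exact: h1.
  exact: contrapT.
- by case: h1 => k kn; apply: h3; lia.
- by case: h1 => k kn; apply: h3; lia.
Qed.

(** An unbounded quantifier costs nothing when the witnesses are bounded. *)
Lemma cpred_ex (R : nat -> nat -> Prop) b :
  (forall x k, R x k -> k < b x) ->
  cpred X (fun z => R (pr1 z) (pr2 z)) -> cfun X b ->
  cpred X (fun x => exists k, R x k).
Proof.
move=> bR hR hb.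
have := cpred_not (cpred_all (R := fun x k => ~ R x k) (cpred_not hR) hb).
apply: cpred_ext => x; split=> [h|[k Rk] h]; last exact: h (bR _ _ Rk) Rk.
by apply: contrapT => h'; apply: h => k _ Rk; apply: h'; exists k.
Qed.

Lemma cpred_ex2 (R : nat -> nat -> Prop) b :
  cpred X (fun z => R (pr1 z) (pr2 z)) -> cfun X b ->
  cpred X (fun x => exists2 k, k < b x & R x k).
Proof.
move=> hR hb; suff: cpred X (fun x => exists k, k < b x /\ R x k).
  by apply: cpred_ext => x; split=> -[k]; [move=> []|]; exists k.
apply: (cpred_ex (b := b)) => //; first by move=> x k [].
have lt_b := cpred_lt (cfun_pr2 cfun_id) (cfun_comp hb (cfun_pr1 cfun_id)).
exact: cpred_and lt_b hR.
Qed.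

Lemma cpred_mem f g :
  cfun X f -> cfun X g -> cpred X (fun x => mem (f x) (g x)).
Proof.
apply: cpred_comp2.
(* Later entries are 0, like the entry number [d] itself. *)
have : cpred X (fun z => exists2 i, i < (pr1 z).+1 & entry (pr1 z) i = pr2 z).
  apply: (cpred_ex2 (R := fun z i => entry (pr1 z) i = pr2 z)).
    apply: cpred_eq; last exact: cfun_pr2 (cfun_pr1 cfun_id).
    exact: cfun_entry (cfun_pr1 (cfun_pr1 cfun_id)) (cfun_pr2 cfun_id).
  exact: cfun_succ (cfun_pr1 cfun_id).
by apply: cpred_ext => z; rewrite memP.
Qed.

Lemma cfun_search (R : nat -> nat -> Prop) :
  cpred X (fun z => R (pr1 z) (pr2 z)) -> (forall x, exists k, R x k) ->
  exists2 f, cfun X f & forall x, R x (f x).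
Proof.
move=> /cpred_not [c hc] exR.
have exb x : exists k, `[< R x k >] by have [k /asboolP] := exR x; exists k.
exists (fun x => ex_minn (exb x)); last first.
  by move=> x; case: ex_minnP => k /asboolP.
exists (CMin c) => n m /=; case: ex_minnP => k /asboolP Rk kmin.
rewrite hc pr1E pr2E; split=> [[]|->].
  case: asboolP => // /contrapT Rm _ h; apply/eqP; rewrite eqn_leq.
  rewrite [k <= m]kmin ?andbT; last exact/asboolP.
  rewrite leqNgt; apply/negP => /h [v /hc].
  by rewrite pr1E pr2E; case: asboolP.
split=> [|i ik]; first by case: asboolP.
exists 0; apply/hc; rewrite pr1E pr2E.
case: asboolP => // /contrapT /asboolP /kmin.
by lia.
Qed.

Lemma cpred_computes (Y : set nat) : cpred X Y -> computes X Y.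
Proof.
by move=> [c hc]; exists c => n; split=> Yn; apply/hc; case: asboolP.
Qed.

Lemma cpred_oracle f : cfun X f -> cpred X (fun x => X (f x)).
Proof.
move=> hf; apply: (cpred_comp (P := X)) hf; exists COracle => n m /=.
by case: asboolP => h; split=> [[[]|[]]|->] //; [left | right].
Qed.

(** Post's theorem: a set enumerable together with its complement is
    computable, by searching for a witness of either kind. *)
Lemma computes_of_enumerations (Y : set nat) (P N : nat -> nat -> Prop) :
  cpred X (fun z => P (pr1 z) (pr2 z)) ->
  cpred X (fun z => N (pr1 z) (pr2 z)) ->
  (forall e, Y e <-> exists z, P e z) ->
  (forall e, ~ Y e <-> exists z, N e z) ->
  computes X Y.
Proof.
move=> hP hN YP YN; apply: cpred_computes.
have [f hf PN] : exists2 f, cfun X f & forall e, P e (f e) \/ N e (f e).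
  apply: (cfun_search (R := fun e z => P e z \/ N e z)); first exact: cpred_or.
  move=> e; have [/YP[z Pz]|/YN[z Nz]] := pselect (Y e); exists z.
    by left.
  by right.
have := cpred_comp2 hP cfun_id hf; apply: cpred_ext => e.
split=> [Pe|Ye]; first by apply/YP; exists (f e).
by have [//|Ne] := PN e; have /YN : exists z, N e z by exists (f e).
Qed.

End Closure.

(** Closure lemmas are selected by the syntax of the body rather than by
    unification, which would unfold arithmetic.  Existential quantifiers are
    left open, since they need a bound: this is the argument of [cauto_ex]. *)
Ltac cauto := cbn beta; lazymatch goal with
  | |- cfun _ (fun x => x) => exact: cfun_id
  | |- cfun _ pr1 => exact: (cfun_pr1 (cfun_id _))
  | |- cfun _ pr2 => exact: (cfun_pr2 (cfun_id _))
  | |- cfun _ (fun x => S (@?f x)) => apply: (cfun_succ (f := f)); cauto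
  | |- cfun _ (fun x => pr1 (@?f x)) => apply: (cfun_pr1 (f := f)); cauto
  | |- cfun _ (fun x => pr2 (@?f x)) => apply: (cfun_pr2 (f := f)); cauto
  | |- cfun _ (fun x => pr (@?f x) (@?g x)) =>
      apply: (cfun_pr (f := f) (g := g)); cauto
  | |- cfun _ (fun x => entry (@?f x) (@?g x)) =>
      apply: (cfun_entry (f := f) (g := g)); cauto
  | |- cfun _ (fun x => addn (@?f x) (@?g x)) =>
      apply: (cfun_add (f := f) (g := g)); cauto
  | |- cfun _ (fun x => muln ?k (@?f x)) =>
      apply: (cfun_mulc k (f := f)); cauto
  | |- cpred _ (fun x => @?P x /\ @?Q x) =>
      apply: (cpred_and (P := P) (Q := Q)); cauto
  | |- cpred _ (fun x => @?P x \/ @?Q x) =>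
      apply: (cpred_or (P := P) (Q := Q)); cauto
  | |- cpred _ (fun x => ~ @?P x) => apply: (cpred_not (P := P)); cauto
  | |- cpred _ (fun x => @?f x = @?g x) =>
      apply: (cpred_eq (f := f) (g := g)); cauto
  | |- cpred _ (fun x => is_true (leq (S (@?f x)) (@?g x))) =>
      apply: (cpred_lt (f := f) (g := g)); cauto
  | |- cpred _ (fun x => mem (@?f x) (@?g x)) =>
      apply: (cpred_mem (f := f) (g := g)); cauto
  | |- cpred _ (fun x => forall k, is_true (leq (S k) (@?b x)) -> @?R x k) =>
      apply: (cpred_all (R := R) (b := b)); cauto
  | |- cpred _ (fun x => exists2 k, is_true (leq (S k) (@?b x)) & @?R x k) =>
      apply: (cpred_ex2 (R := R) (b := b)); cauto
  | |- cfun _ _ => first [exact: cfun_cst | idtac]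
  | |- _ => idtac
  end.

Ltac cauto_ex bound := lazymatch goal with
  | |- cpred _ (fun x => exists k, @?R x k) =>
      apply: (cpred_ex (R := R) (b := bound)); cauto
  end.

(** * Finite derivations of oracle computations *)

(** The clauses of [eval] as one-step justifications of the statement that the
    program numbered [c] maps [n] to [m], from statements in [D].  A premise
    always has a smaller program, or the same primitive recursion at a smaller
    stage, so that no order on [D] is needed to exclude circularity. *)
Definition justified (O : nat -> Prop) (D : nat -> nat -> nat -> Prop)
    (c n m : nat) : Prop :=
  (c = 0 /\ m = 0) \/ (c = 1 /\ m = n.+1) \/
  (c = 2 /\ m = pr1 n) \/ (c = 3 /\ m = pr2 n) \/
  (c = 4 /\ (O n /\ m = 1 \/ ~ O n /\ m = 0)) \/
  (exists q, c = 4 * q + 5 /\ D (pr1 q) n (pr1 m) /\ D (pr2 q) n (pr2 m)) \/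
  (exists q, c = 4 * q + 6 /\ exists k, D (pr2 q) n k /\ D (pr1 q) k m) \/
  (exists q, c = 4 * q + 7 /\
    (pr2 n = 0 /\ D (pr1 q) (pr1 n) m \/
     exists k, pr2 n = k.+1 /\
       exists u, D c (pr (pr1 n) k) u /\
                 D (pr2 q) (pr (pr1 n) (pr k u)) m)) \/
  (exists q, c = 4 * q + 8 /\ D q (pr n m) 0 /\
    forall k, k < m -> exists v, D q (pr n k) v.+1).

Definition holds (d c n m : nat) : Prop := mem d (pr c (pr n m)).

Definition closed (O : nat -> Prop) (d : nat) : Prop :=
  forall i, i < d.+1 ->
    justified O (holds d) (pr1 (entry d i)) (pr1 (pr2 (entry d i)))
              (pr2 (pr2 (entry d i))).

Definition halts_by (O : nat -> Prop) (d e : nat) : Prop :=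
  (exists m, holds d e e m) /\ closed O d.

Lemma closedP O d : closed O d <->
  forall c n m, holds d c n m -> justified O (holds d) c n m.
Proof.
split=> [h c n m /memP[i /h]|h i _].
  by move=> + ei; rewrite ei !(pr1E, pr2E).
by apply: h; rewrite /holds !prK; exists i.
Qed.

(** A justification looks at the oracle only at its own input [n]; this
    locality is what allows the oracle to be approximated. *)
Lemma justified_mono (O O' : nat -> Prop) (D D' : nat -> nat -> nat -> Prop)
    c n m :
  (O n <-> O' n) -> (forall c n m, D c n m -> D' c n m) ->
  justified O D c n m -> justified O' D' c n m.
Proof.
move=> OO' DD' [h|[h|[h|[h|[h|[h|[h|[h|h]]]]]]]].
- by left.
- by right; left.
- by do 2 right; left.
- by do 3 right; left.
- by do 4 right; left; rewrite -OO'.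
- by do 5 right; left; case: h => q [cq [/DD' ? /DD' ?]]; exists q.
- do 6 right; left; case: h => q [cq [k [/DD' ? /DD' ?]]].
  by exists q; split=> //; exists k.
- do 7 right; left; case: h => q [cq h]; exists q; split=> //.
  case: h => [[n0 /DD' ?]|[k [nk [u [/DD' ? /DD' ?]]]]]; first by left.
  by right; exists k; split=> //; exists u.
- do 8 right; case: h => q [cq [/DD' ? h]]; exists q; do 2 split=> //.
  by move=> k /h[v /DD' ?]; exists v.
Qed.

(** Primitive recursion as a self-reference, the form in which [justified]
    treats it. *)
Lemma eval_prec X f g n m : eval X (CPrec f g) n m <->
  (pr2 n = 0 /\ eval X f (pr1 n) m) \/
  exists k, pr2 n = k.+1 /\ exists u, eval X (CPrec f g) (pr (pr1 n) k) u /\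
    eval X g (pr (pr1 n) (pr k u)) m.
Proof.
rewrite /=; case E : (pr2 n) => [|k].
  by split=> [h|[[]|[k []]]] //; left.
split=> [[u h1 h2]|[[]|[_ [[<-] [u [h1 h2]]]]]] //.
  by right; exists k; split=> //; exists u; rewrite pr1E pr2E.
by exists u => //; move: h1; rewrite pr1E pr2E.
Qed.

(** Discards a clause of [justified] whose program number has the wrong
    residue. *)
Ltac mismatch :=
  first [by move=> [+ _]; lia | by move=> [? [+ _]]; lia].

(** By induction on the program, then on the stage for primitive recursion:
    the justification of an entry mentions only entries already handled. *)
Lemma closed_sound X d c n m :
  closed X d -> holds d (encode c) n m -> eval X c n m.
Proof.
move=> /closedP cl.
have split_pr f g q k : 4 * pr (encode f) (encode g) + k = 4 * q + k ->
    pr1 q = encode f /\ pr2 q = encode g.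
  move=> e; have -> : q = pr (encode f) (encode g) by lia.
  by rewrite pr1E pr2E.
elim: c n m => [|||||f IHf g IHg|f IHf g IHg|f IHf g IHg|f IHf] n m.
1-5: by move/cl => /= [|[|[|[|[|[|[|[|]]]]]]]]; try mismatch; case.
- move/cl => /= [|[|[|[|[|[|[|[|]]]]]]]]; try mismatch.
  move=> [q [/split_pr[ef eg]]].
  rewrite ef eg => -[/IHf hf /IHg hg].
  by exists (pr1 m), (pr2 m); rewrite prK.
- move/cl => /= [|[|[|[|[|[|[|[|]]]]]]]]; try mismatch.
  move=> [q [/split_pr[ef eg]]].
  by rewrite ef eg => -[k [/IHg hg /IHf hf]]; exists k.
- move E : (pr2 n) => k; elim: k n m E => [|k IH] n m E.
    move/cl => /= [|[|[|[|[|[|[|[|]]]]]]]]; try mismatch.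
    move=> [q [/split_pr[ef eg]]].
    by rewrite ef E => -[[_ /IHf]|[k []]].
  move/cl => /= [|[|[|[|[|[|[|[|]]]]]]]]; try mismatch.
  move=> [q [/split_pr[ef eg]]].
  move=> [[]|[k' []]]; rewrite E // => -[<-] [u []].
  rewrite eg => /IH h /IHg hg; exists u => //.
  by have := h (pr2E _ _); rewrite /= pr1E pr2E.
- move/cl => /= [|[|[|[|[|[|[|[|]]]]]]]]; try mismatch.
  move=> [q [eq]]; have -> : q = encode f by lia.
  by move=> [/IHf h0 h]; split=> // k /h[v /IHf hv]; exists v.
Qed.

(** For completeness, derivations are built as lists, where union is
    concatenation; they become numbers only in [derivable_closed]. *)
Definition listed (s : seq nat) (c n m : nat) : Prop := pr c (pr n m) \in s.

Definition self_justified (O : nat -> Prop) (s : seq nat) : Prop :=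
  forall c n m, listed s c n m -> justified O (listed s) c n m.

Definition derivable (O : nat -> Prop) (c n m : nat) : Prop :=
  exists2 s, self_justified O s & listed s c n m.

Lemma listed_cat s1 s2 c n m :
  listed (s1 ++ s2) c n m <-> listed s1 c n m \/ listed s2 c n m.
Proof. by rewrite /listed mem_cat; split=> [/orP|/orP]. Qed.

Lemma self_justified_cat O s1 s2 :
  self_justified O s1 -> self_justified O s2 -> self_justified O (s1 ++ s2).
Proof.
move=> h1 h2 c n m /listed_cat[/h1|/h2]; apply: justified_mono => // *;
  by apply/listed_cat; first [by left | by right].
Qed.

Lemma derivable_from O s c n m :
  self_justified O s -> justified O (listed s) c n m -> derivable O c n m.
Proof.
move=> hs j; exists (pr c (pr n m) :: s); last by rewrite /listed inE eqxx.
move=> c' n' m'; rewrite /listed inE.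
move=> /orP[/eqP/pr_inj[-> /pr_inj[-> ->]]|/hs].
  by apply: justified_mono j => // *; rewrite /listed inE; apply/orP; right.
by apply: justified_mono => // *; rewrite /listed inE; apply/orP; right.
Qed.

Lemma derivable_pair O c n m c' n' m' :
  derivable O c n m -> derivable O c' n' m' ->
  exists s, [/\ self_justified O s, listed s c n m & listed s c' n' m'].
Proof.
move=> [s hs st] [s' hs' st']; exists (s ++ s'); split.
- exact: self_justified_cat.
- by apply/listed_cat; left.
- by apply/listed_cat; right.
Qed.

(** Unbounded search has a premise for each smaller argument; these finitely
    many derivations are merged into one. *)
Lemma derivable_family O (c : nat) (n : nat -> nat) b :
  (forall k, k < b -> exists v, derivable O c (n k) v.+1) ->
  exists2 s, self_justified O s &
    forall k, k < b -> exists v, listed s c (n k) v.+1.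
Proof.
elim: b => [|b IH] h; first by exists [::] => // c' n' m'; rewrite /listed.
have [|s hs sk] := IH; first by move=> k kb; apply: h; lia.
have [v [s' hs' sv]] := h b (ltnSn b).
exists (s ++ s'); first exact: self_justified_cat.
move=> k; rewrite ltnS leq_eqVlt => /orP[/eqP ->|/sk[u su]].
  by exists v; apply/listed_cat; right.
by exists u; apply/listed_cat; left.
Qed.

Lemma derivable_justified O c n m :
  justified O (derivable O) c n m -> derivable O c n m.
Proof.
have nil : self_justified O [::] by move=> c' n' m'; rewrite /listed.
move=> [h|[h|[h|[h|[h|[h|[h|[h|h]]]]]]]].
- by apply: (derivable_from nil); left.
- by apply: (derivable_from nil); right; left.
- by apply: (derivable_from nil); do 2 right; left.
- by apply: (derivable_from nil); do 3 right; left.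
- by apply: (derivable_from nil); do 4 right; left.
- case: h => q [cq [/derivable_pair h /h[s [hs h1 h2]]]].
  by apply: (derivable_from hs); do 5 right; left; exists q.
- case: h => q [cq [k [/derivable_pair h /h[s [hs h1 h2]]]]].
  apply: (derivable_from hs); do 6 right; left; exists q; split=> //.
  by exists k.
- case: h => q [cq [[n0 [s hs h1]]|[k [nk [u []]]]]].
    by apply: (derivable_from hs); do 7 right; left; exists q; split=> //; left.
  move=> /derivable_pair h /h[s [hs h1 h2]].
  apply: (derivable_from hs); do 7 right; left; exists q; split=> //; right.
  by exists k; split=> //; exists u.
- case: h => q [cq [[s hs h0] /derivable_family[s' hs' hk]]].
  apply: (derivable_from (self_justified_cat hs hs')); do 8 right; exists q.
  split=> //; split=> [|k /hk[v ?]]; first by apply/listed_cat; left.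
  by exists v; apply/listed_cat; right.
Qed.

Lemma eval_derivable X c n m : eval X c n m -> derivable X (encode c) n m.
Proof.
elim: c n m => [|||||f IHf g IHg|f IHf g IHg|f IHf g IHg|f IHf] n m.
- by move=> e; apply: derivable_justified; left.
- by move=> e; apply: derivable_justified; right; left.
- by move=> e; apply: derivable_justified; do 2 right; left.
- by move=> e; apply: derivable_justified; do 3 right; left.
- by move=> e; apply: derivable_justified; do 4 right; left.
- move=> /= [a [b [/IHf hf /IHg hg ->]]]; apply: derivable_justified.
  do 5 right; left; exists (pr (encode f) (encode g)).
  by rewrite !(pr1E, pr2E).
- move=> /= [k /IHg hg /IHf hf]; apply: derivable_justified.
  do 6 right; left; exists (pr (encode f) (encode g)).
  by rewrite !(pr1E, pr2E); split=> //; exists k.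
- move E : (pr2 n) => k; elim: k n m E => [|k IH] n m E /eval_prec h;
    apply: derivable_justified; do 7 right; left;
    exists (pr (encode f) (encode g)); rewrite !(pr1E, pr2E); split=> //.
    by left; case: h => [[_ /IHf]|[k []]] //; rewrite E.
  right; case: h => [[]|[k' []]]; rewrite E // => -[<-] [u [hu /IHg hg]].
  by exists k; split=> //; exists u; split=> //; apply: IH hu; rewrite pr2E.
- move=> /= [/IHf h0 h]; apply: derivable_justified; do 8 right.
  exists (encode f); do 2 split=> //.
  by move=> k /h[v /IHf hv]; exists v.
Qed.

Lemma derivable_closed O c n m : derivable O c n m ->
  exists2 d, closed O d & holds d c n m.
Proof.
move=> [s hs st]; pose d := foldr pr 0 s.
have sub c' n' m' : listed s c' n' m' -> holds d c' n' m'.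
  move=> h; exists (index (pr c' (pr n' m')) s).
  by rewrite entry_foldr nth_index.
exists d; last exact: sub.
apply/closedP => c' n' m' [i]; rewrite entry_foldr => ei.
have [h|h] := ltnP i (size s).
  by apply: justified_mono (hs c' n' m' _) => //; rewrite /listed -ei mem_nth.
(* Past the end of [s] every entry is 0, the code of the triple (0, 0, 0):
   the program encoded by 0 does output 0. *)
left; have : pr c' (pr n' m') = pr 0 (pr 0 0) by rewrite -ei nth_default.
by move=> /pr_inj[-> /pr_inj[_ ->]].
Qed.

Lemma jumpP X e : jump X e <-> exists d, halts_by X d e.
Proof.
split=> [[c ce [m /eval_derivable/derivable_closed[d cl h]]]|[d [[m h] cl]]].
  by exists d; split=> //; exists m; rewrite ce in h.
by have [c ce] := encode_surj e; exists c => //; exists m;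
  apply: closed_sound cl _; rewrite ce.
Qed.

(** * A Sigma_2 definition of the double jump *)

Lemma holds_le d c n m : holds d c n m -> m < d.+1.
Proof.
move=> /mem_le; have [_ h1] := pr_bounds c (pr n m).
by have [_ h2] := pr_bounds n m; lia.
Qed.

Lemma cpred_justified X (O : nat -> nat -> Prop) w d c n m :
  cpred X (fun z => O (pr1 z) (pr2 z)) ->
  cfun X w -> cfun X d -> cfun X c -> cfun X n -> cfun X m ->
  cpred X (fun x => justified (O (w x)) (holds (d x)) (c x) (n x) (m x)).
Proof.
move=> hO hw hd hc hn hm.
suff H : cpred X (fun z =>
  justified (O (pr1 z)) (holds (pr1 (pr2 z))) (pr1 (pr2 (pr2 z)))
    (pr1 (pr2 (pr2 (pr2 z)))) (pr2 (pr2 (pr2 (pr2 z))))).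
  have := cpred_comp H (cfun_pr hw (cfun_pr hd (cfun_pr hc (cfun_pr hn hm)))).
  by apply: cpred_ext => x; rewrite !(pr1E, pr2E).
rewrite /justified /holds; cauto.
1-2: by apply: (cpred_comp2 (R := O)) => //; cauto.
- cauto_ex (fun z => (pr1 (pr2 (pr2 z))).+1).
  by move=> x k; lia.
- cauto_ex (fun z => (pr1 (pr2 (pr2 z))).+1).
    by move=> x k; lia.
  cauto_ex (fun z => (pr1 (pr2 (pr1 z))).+1).
  by move=> x k [/holds_le].
- cauto_ex (fun z => (pr1 (pr2 (pr2 z))).+1).
    by move=> x k; lia.
  cauto_ex (fun z => pr2 (pr1 (pr2 (pr2 (pr2 (pr1 z)))))).
    by move=> x k []; lia.
  cauto_ex (fun z => (pr1 (pr2 (pr1 (pr1 z)))).+1).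
  by move=> x k [/holds_le].
- cauto_ex (fun z => (pr1 (pr2 (pr2 z))).+1).
    by move=> x k; lia.
  cauto_ex (fun z => (pr1 (pr2 (pr1 (pr1 z)))).+1).
  by move=> x k /holds_le; lia.
Qed.

Lemma cpred_halts_by X (O : nat -> nat -> Prop) w d e :
  cpred X (fun z => O (pr1 z) (pr2 z)) ->
  cfun X w -> cfun X d -> cfun X e ->
  cpred X (fun x => halts_by (O (w x)) (d x) (e x)).
Proof.
move=> hO hw hd he.
suff H : cpred X (fun z => halts_by (O (pr1 z)) (pr1 (pr2 z)) (pr2 (pr2 z))).
  have := cpred_comp H (cfun_pr hw (cfun_pr hd he)).
  by apply: cpred_ext => x; rewrite !(pr1E, pr2E).
rewrite /halts_by /closed; cauto.
  rewrite /holds; cauto_ex (fun z => (pr1 (pr2 z)).+1).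
  by move=> x k /holds_le.
by apply: (cpred_justified (w := fun z => pr1 (pr1 z))
  (d := fun z => pr1 (pr2 (pr1 z)))) => //; cauto.
Qed.

(** Stage [w] of an approximation of 0' from below. *)
Definition jump_before (w q : nat) : Prop :=
  exists2 d, d < w & halts_by (fun=> False) d q.

(** [k] proposes a derivation together with a stage from which the
    approximation of 0' is right on all its queries; [s] tests one later
    stage. *)
Definition sigma2 (e k s : nat) : Prop :=
  halts_by (jump_before (pr2 k + s)) (pr1 k) e.

Lemma cpred_jump_before X :
  cpred X (fun z => jump_before (pr1 z) (pr2 z)).
Proof.
rewrite /jump_before; cauto.
apply: (cpred_halts_by (O := fun _ _ => False) (w := fun z => z)); cauto.
by apply: cpred_ext (cpred_lt (cfun_cst X 0) (cfun_cst X 0)) => x; lia.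
Qed.

Lemma cpred_sigma2 X e k s : cfun X e -> cfun X k -> cfun X s ->
  cpred X (fun x => sigma2 (e x) (k x) (s x)).
Proof.
by move=> he hk hs; apply: (cpred_halts_by (cpred_jump_before X)); cauto.
Qed.

Lemma jump_limit q : exists w, forall w', w <= w' ->
  (jump_before w' q <-> jump set0 q).
Proof.
have [/jumpP[d h]|h] := pselect (jump set0 q).
  exists d.+1 => w' dw; split=> [[d' _ h']|_]; first by apply/jumpP; exists d'.
  by exists d.
exists 0 => w' _; split=> [[d' _ h']|//].
by apply/jumpP; exists d'.
Qed.

Lemma jump_limit_unif (q : nat -> nat) b : exists w, forall i, i < b ->
  forall w', w <= w' -> (jump_before w' (q i) <-> jump set0 (q i)).
Proof.
elim: b => [|b [w hw]]; first by exists 0.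
have [v hv] := jump_limit (q b); exists (w + v) => i.
by rewrite ltnS leq_eqVlt => /orP[/eqP ->|ib] w' ?; [apply: hv|apply: hw]; lia.
Qed.

(** A derivation makes finitely many queries, so its justifications hold at
    all late stages; conversely each entry makes one query, and its
    justification at a stage where that query has settled is a true one. *)
Lemma sigma2P e : jump (jump set0) e <-> exists k, forall s, sigma2 e k s.
Proof.
split=> [/jumpP[d [[m h] cl]]|[k hk]].
  have [w hw] := jump_limit_unif (fun i => pr1 (pr2 (entry d i))) d.+1.
  exists (pr d w) => s; rewrite /sigma2 pr1E pr2E; split; first by exists m.
  move=> i id; apply: justified_mono (cl i id) => //.
  by split=> /hw; apply=> //; lia.
apply/jumpP; exists (pr1 k); split; first by case: (hk 0).
move=> i id; have [w hw] := jump_limit (pr1 (pr2 (entry (pr1 k) i))).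
have [_ cl] := hk w; apply: justified_mono (cl i id) => //.
by apply: hw; lia.
Qed.

(** * The coding graph *)

(** [exists s, witness j n s] says that [n] belongs to the c.e. initial segment
    [W j] of the introduction; [s] bounds the search for counterexamples to
    [sigma2] when [j] is a pair with second component 0. *)
Definition witness (j n s : nat) : Prop :=
  (pr2 j = 0 /\ forall k, k < n -> exists2 t, t < s & ~ sigma2 (pr1 j) k t) \/
  (exists k, pr2 j = k.+1 /\ forall t, t < n -> sigma2 (pr1 j) k t).

Definition unbounded (j : nat) : Prop := forall n, exists s, witness j n s.

Lemma witness_anti j n n' s : n <= n' -> witness j n' s -> witness j n s.
Proof.
move=> nn' [[j0 h]|[k [jk h]]]; [left | right; exists k]; split=> // i ni;
  apply: h; lia.
Qed.

Lemma unbounded_succ e k : unbounded (pr e k.+1) <-> forall s, sigma2 e k s.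
Proof.
split=> [h s|h n]; last by exists 0; right; exists k; rewrite pr1E pr2E; split.
have [w [[]|[k' []]]] := h s.+1; rewrite pr2E // => -[<-].
by rewrite pr1E; apply.
Qed.

Lemma unbounded0 e : unbounded (pr e 0) <-> forall k, exists s, ~ sigma2 e k s.
Proof.
split=> [h k|h].
  have [w [[_]|[k' []]]] := h k.+1; rewrite ?pr2E // pr1E.
  by move=> /(_ k (ltnSn k))[s _]; exists s.
move=> n.
suff [s hs] : exists s, forall k, k < n -> exists2 t, t < s & ~ sigma2 e k t.
  by exists s; left; rewrite pr1E pr2E.
elim: n => [|n [s hs]]; first by exists 0.
have [t ht] := h n; exists (s + t.+1) => k.
rewrite ltnS leq_eqVlt => /orP[/eqP ->|/hs[u us hu]].
  by exists t => //; lia.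
by exists u => //; lia.
Qed.

Lemma double_jumpP e :
  jump (jump set0) e <-> exists k, unbounded (pr e k.+1).
Proof.
by rewrite sigma2P; split=> -[k h]; exists k; apply/unbounded_succ.
Qed.

Lemma double_jumpNP e : ~ jump (jump set0) e <-> unbounded (pr e 0).
Proof.
rewrite sigma2P unbounded0; split=> [h k|h [k hk]].
  apply: contrapT => hk; apply: h; exists k => s.
  by apply: contrapT => hs; apply: hk; exists s.
by have [s] := h k; apply.
Qed.

(** The tag in the first component separates the kinds of vertices; a number
    with another tag is an isolated vertex. *)
Definition ray (j : nat) : nat := pr 0 j.
Definition track (n : nat) : nat := pr 1 n.
Definition wit (j n s : nat) : nat := pr 2 (pr j (pr n s)).
Definition hub (i : nat) : nat := pr 3 i.

Definition arc (u v : nat) : Prop :=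
  (pr1 u = 0 /\ v = ray (pr2 u).+1) \/
  (pr1 u = 0 /\ v = hub (pr2 u %% 3)) \/
  (pr1 u = 2 /\
   witness (pr1 (pr2 u)) (pr1 (pr2 (pr2 u))) (pr2 (pr2 (pr2 u))) /\
   (v = ray (pr1 (pr2 u)) \/ v = track (pr1 (pr2 (pr2 u))))).

Definition link (u v : nat) : Prop := arc u v \/ arc v u.

Lemma link_sym u v : link u v -> link v u.
Proof. by case; [right | left]. Qed.

(** The same relation in a form suited to inversion; [arc] itself is written so
    that its computability is evident. *)
Variant arc_spec : nat -> nat -> Prop :=
| ArcRay j : arc_spec (ray j) (ray j.+1)
| ArcHub j : arc_spec (ray j) (hub (j %% 3))
| ArcWitRay j n s of witness j n s : arc_spec (wit j n s) (ray j)
| ArcWitTrack j n s of witness j n s : arc_spec (wit j n s) (track n).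

Lemma arcP u v : arc u v <-> arc_spec u v.
Proof.
split.
  rewrite -[u]prK.
  case=> [[]|[[]|[]]]; rewrite !(pr1E, pr2E) => ->.
  - by move=> ->; apply: ArcRay.
  - by move=> ->; apply: ArcHub.
  - move=> [w [] ->].
      by have := ArcWitRay w; rewrite /wit !prK.
    by have := ArcWitTrack w; rewrite /wit !prK.
case=> [j|j|j n s w|j n s w].
- by left; rewrite pr1E pr2E.
- by right; left; rewrite pr1E pr2E.
- by do 2 right; rewrite !(pr1E, pr2E); do 2 split=> //; left.
- by do 2 right; rewrite !(pr1E, pr2E); do 2 split=> //; right.
Qed.

Lemma link_irrefl u : ~ link u u.
Proof.
suff h : ~ arc u u by case.
move=> /arcP; move E : {2}u => v a.
case: a E => [j|j|j n s _|j n s _] /pr_inj[] //.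
by lia.
Qed.

Definition coding_graph : graph nat :=
  @Graph nat setT link (ex_intro _ 0 I) (fun _ _ _ => conj I I)
    link_sym link_irrefl.

Lemma link_ray j : link (ray j) (ray j.+1).
Proof. by left; apply/arcP; apply: ArcRay. Qed.

Lemma link_hub j : link (ray j) (hub (j %% 3)).
Proof. by left; apply/arcP; apply: ArcHub. Qed.

Lemma link_wit j n s : witness j n s ->
  link (wit j n s) (ray j) /\ link (wit j n s) (track n).
Proof.
by move=> w; split; left; apply/arcP; [apply: ArcWitRay|apply: ArcWitTrack].
Qed.

Ltac arc_cases := let a := fresh in
  move/arcP => a; inversion a; clear a;
  repeat match goal with H : _ = _ :> nat |- _ =>
    move/pr_inj: H => [? ?] end; subst => //.

(** The neighbours of [ray j] on the path have indices differing by 2, hence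
    distinct residues modulo 3. *)
Lemma link_ray_next j v :
  link (ray j) v -> link v (hub (j.+1 %% 3)) -> v = ray j.+1.
Proof.
move=> jv vh; have [i vi ij] : exists2 i, v = ray i & i %% 3 = j.+1 %% 3.
  by case: vh; arc_cases; eexists.
rewrite vi in jv *.
by case: jv; arc_cases; lia.
Qed.

(** Only the [wit] vertices are adjacent to a track vertex. *)
Lemma link_common j n v :
  link v (ray j) -> link v (track n) -> exists s, witness j n s.
Proof.
move=> vj vn.
have [i [s vi w]] : exists i, exists2 s, v = wit i n s & witness i n s.
  by case: vn; arc_cases; do 2 eexists.
rewrite vi in vj; exists s.
by case: vj; arc_cases.
Qed.

(** * Computability of the coding graph *)

Lemma cfun_mod3 X f : cfun X f -> cfun X (fun x => f x %% 3).
Proof.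
apply: (cfun_comp (f := fun x => x %% 3)).
have [||g hg gP] := @cfun_search X
    (fun x r => (exists q, x = 3 * q + r) /\ r < 3).
- cauto; cauto_ex (fun z => (pr1 z).+1).
  by move=> x k; lia.
- by move=> x; exists (x %% 3); split; [exists (x %/ 3)|]; lia.
by apply: cfun_ext hg => x; have [[q e] lt3] := gP x; lia.
Qed.

Lemma cpred_witness X j n s : cfun X j -> cfun X n -> cfun X s ->
  cpred X (fun x => witness (j x) (n x) (s x)).
Proof.
move=> hj hn hs.
suff H : cpred X (fun z => witness (pr1 z) (pr1 (pr2 z)) (pr2 (pr2 z))).
  have := cpred_comp H (cfun_pr hj (cfun_pr hn hs)).
  by apply: cpred_ext => x; rewrite !(pr1E, pr2E).
rewrite /witness; cauto.
  by apply: cpred_sigma2; cauto.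
cauto_ex (fun z => pr2 (pr1 z)); first by move=> x k []; lia.
by apply: cpred_sigma2; cauto.
Qed.

Lemma cpred_arc X f g :
  cfun X f -> cfun X g -> cpred X (fun x => arc (f x) (g x)).
Proof.
apply: cpred_comp2; rewrite /arc /ray /track /hub; cauto.
  by apply: cfun_mod3; cauto.
by apply: cpred_witness; cauto.
Qed.

Lemma coding_graph_computable : computable (diagram coding_graph).
Proof.
apply: cpred_computes.
have : cpred set0 (fun n => (exists q, n = 2 * q) \/
    exists q, n = 2 * q + 1 /\ (arc (pr1 q) (pr2 q) \/ arc (pr2 q) (pr1 q))).
  cauto.
    by cauto_ex (fun z => z.+1) => x k; lia.
  cauto_ex (fun z => z.+1); first by move=> x k; lia.
  1-2: by apply: cpred_arc; cauto.
apply: cpred_ext => n; split=> [[[q ->]|[q [-> h]]]|[[q _ <-]|[x [y [h ->]]]]].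
- by left; exists q.
- by right; exists (pr1 q), (pr2 q); rewrite prK.
- by left; exists q.
- by right; exists (pr x y); rewrite pr1E pr2E.
Qed.

(** * Elements of the cohesive power *)

Lemma total_pcomputable f : cfun set0 f -> pcomputable (fun n => Some (f n)).
Proof. by move=> [c hc]; exists c => n m; rewrite hc; split=> [[]|->]. Qed.

Lemma always_almost (C X : set nat) : (forall n, X n) -> C `<=*` X.
Proof.
move=> h; rewrite /almost_subset (_ : _ `\` _ = set0) //.
by apply/seteqP; split=> // n [_ nX]; apply: nX.
Qed.

Lemma total_power_fun C f :
  cfun set0 f -> power_fun coding_graph C (fun n => Some (f n)).
Proof.
move=> hf; split=> //; first exact: total_pcomputable.
by apply: always_almost => n; exists (f n).
Qed.

Lemma almost_infinitely_often (C X : set nat) N :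
  infinite_set C -> C `<=*` X -> exists2 n, N <= n & X n.
Proof.
move=> infC CX; apply: contrapT => h; apply: infC.
have fin : finite_set ((C `\` X) `|` `I_N) by rewrite finite_setU; split.
apply: sub_finite_set fin => n Cn.
have [nN|Nn] := ltnP n N; first by right.
by left; split=> // Xn; apply: h; exists n.
Qed.

(** * Decoding a presentation *)

Section Presented.
Variables (C : set nat) (hC : cohesive C) (A : graph nat).
Variable f : nat -> set pfun.
Hypothesis f_bij : set_bij (vert A) (power_vert coding_graph C) f.
Hypothesis f_edge : forall x y, vert A x -> vert A y ->
  (edge A x y <-> power_edge coding_graph C (f x) (f y)).

Definition represents (u : nat) (phi : pfun) : Prop :=
  [/\ vert A u, power_fun coding_graph C phi &
      f u = power_class coding_graph C phi].

Lemma represents_edge u v phi psi : represents u phi -> represents v psi ->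
  (edge A u v <-> edgeC coding_graph C phi psi).
Proof.
by move=> [Au Dphi eu] [Av Dpsi ev]; rewrite f_edge // eu ev power_edgeE.
Qed.

Lemma represented u : vert A u -> exists phi, represents u phi.
Proof.
case: f_bij => fun_f _ _ Au; have [phi Dphi e] := fun_f u Au.
by exists phi.
Qed.

Lemma represent phi : power_fun coding_graph C phi ->
  exists u, represents u phi.
Proof.
case: f_bij => _ _ surj_f Dphi.
have [|u Au e] := surj_f (power_class coding_graph C phi); first by exists phi.
by exists u.
Qed.

Lemma represents_eqC u phi psi : power_fun coding_graph C psi ->
  represents u phi -> eqC C phi psi -> represents u psi.
Proof.
by move=> Dpsi [Au _ eu] e; split; rewrite // eu; apply/power_class_eq.
Qed.

(** The vertices that have to be constructed can all be taken to stand for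
    total functions. *)
Definition codes (u : nat) (g : nat -> nat) : Prop :=
  represents u (fun n => Some (g n)).

Lemma exists_codes g : cfun set0 g -> exists u, codes u g.
Proof. by move=> hg; apply/represent/total_power_fun. Qed.

Lemma codes_edge u v g h : codes u g -> codes v h ->
  (forall n, link (g n) (h n)) -> edge A u v.
Proof.
move=> ug vh gh; apply/(represents_edge ug vh)/always_almost => n.
by exists (g n), (h n); split; last exact: gh.
Qed.

Lemma edge_codes u v phi h : represents u phi -> codes v h -> edge A u v ->
  C `<=*` [set n | exists2 x, phi n = Some x & link x (h n)].
Proof.
move=> up vh /(represents_edge up vh) e; apply: (almost_sub3 e e) => n.
by move=> [[x [y [px [<-] xy]]] _]; exists x.
Qed.

(** [link_ray_next] holds at almost every coordinate of [C]. *)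
Lemma next_ray u v w j : codes u (fun=> ray j) ->
  codes w (fun=> hub (j.+1 %% 3)) ->
  edge A u v -> edge A v w -> codes v (fun=> ray j.+1).
Proof.
move=> cu cw uv vw; have [_ /represented[phi cv]] := edge_vert uv.
apply: (represents_eqC _ cv); first exact: total_power_fun (cfun_cst _ _).
have h1 := edge_codes cv cu (edge_sym uv).
have h2 := edge_codes cv cw vw.
apply: (almost_sub3 h1 h2) => n [[x px ux] [y]]; rewrite px => -[<-] xw.
exists x; split=> //; congr Some; apply/esym/link_ray_next => //.
exact: link_sym.
Qed.

(** What the presentation can check: [pr1 z] lists a path from [r], oriented by
    [hubs], whose vertex number [j] has a common neighbour [pr2 z] with [a]. *)
Definition marked (hubs r a j z : nat) : Prop :=
  entry (pr1 z) 0 = r /\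
  (forall i, i < j ->
    edge A (entry (pr1 z) i) (entry (pr1 z) i.+1) /\
    edge A (entry (pr1 z) i.+1) (entry hubs (i.+1 %% 3))) /\
  edge A (pr2 z) (entry (pr1 z) j) /\ edge A (pr2 z) a.

Lemma cpred_edge X (x y : nat -> nat) : X = diagram A -> cfun X x -> cfun X y ->
  cpred X (fun n => edge A (x n) (y n)).
Proof.
move=> XA hx hy.
have : cpred X (fun n => X (2 * pr (x n) (y n) + 1)).
  by apply: cpred_oracle; cauto.
apply: cpred_ext => n; rewrite {}XA; split; last by right; exists (x n), (y n).
move=> [[v _]|[v [w [vw e]]]]; first by move=> /=; lia.
have /pr_inj[-> ->] : pr (x n) (y n) = pr v w by lia.
exact: vw.
Qed.

Lemma cpred_marked hubs r a j z :
  cfun (diagram A) j -> cfun (diagram A) z ->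
  cpred (diagram A) (fun x => marked hubs r a (j x) (z x)).
Proof.
apply: cpred_comp2; rewrite /marked; cauto.
all: apply: cpred_edge => //; cauto.
by apply: cfun_mod3; cauto.
Qed.

Lemma cfun_wit j : unbounded j ->
  exists2 s, cfun set0 s & forall n, witness j n (s n).
Proof.
by move=> uj; apply: cfun_search uj; apply: cpred_witness; cauto.
Qed.

(** A common neighbour in the power gives common neighbours of [ray j] and
    [track n] for infinitely many [n], which suffices as the segments are
    downward closed.  Conversely, the least witness is a computable function
    of [n], so that it defines an element of the power. *)
Lemma markedP hubs r a j :
  (forall i, i < 3 -> codes (entry hubs i) (fun=> hub i)) ->
  codes r (fun=> ray 0) -> codes a track ->
  (exists z, marked hubs r a j z) <-> unbounded j.
Proof.
move=> ch cr ca; split=> [[z [z0 [chain [bj ba]]]]|uj].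
  have ray_i i : i <= j -> codes (entry (pr1 z) i) (fun=> ray i).
    elim: i => [|i IH] ij; first by rewrite z0.
    have [e1 e2] := chain i ij; apply: next_ray e1 e2; first by apply: IH; lia.
    by apply: ch; lia.
  have [/represented[phi cb] _] := edge_vert ba.
  have h1 := edge_codes cb (ray_i j (leqnn j)) bj.
  have h2 := edge_codes cb ca ba.
  move=> N; have [infC _] := hC.
  have [n Nn [[x px xj] [y]]] := almost_infinitely_often N infC
    (almost_sub3 h1 h2 (@subset_refl _ _)).
  rewrite px => -[<-] xn; have [s w] := link_common xj xn.
  by exists s; apply: witness_anti w.
have [s hs sw] := cfun_wit uj.
have [g gP] := choice (fun i => exists_codes (cfun_cst set0 (ray i))).
have [b cb] : exists b, codes b (fun n => wit j n (s n)).
  by apply: exists_codes; rewrite /wit; cauto.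
pose g' i := if i is 0 then r else g i.
have g'P i : codes (g' i) (fun=> ray i).
  by case: i => [|i]; [exact: cr | exact: gP].
have ent i : i < j.+1 -> entry (foldr pr 0 (mkseq g' j.+1)) i = g' i.
  by move=> ij; rewrite entry_foldr nth_mkseq.
exists (pr (foldr pr 0 (mkseq g' j.+1)) b).
rewrite /marked pr1E pr2E; split; first exact: ent.
split=> [i ij|].
  rewrite !ent; [|lia..]; split.
    by apply: codes_edge (g'P i) (g'P i.+1) _ => _; apply: link_ray.
  by apply: codes_edge (g'P i.+1) (ch _ _) _ => [|_]; [lia | apply: link_hub].
rewrite ent //; split.
  by apply: codes_edge cb (g'P j) _ => n; case: (link_wit (sw n)).
by apply: codes_edge cb ca _ => n; case: (link_wit (sw n)).
Qed.

Lemma presented_computes : computes (diagram A) (jump (jump set0)).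
Proof.
have [r cr] := exists_codes (cfun_cst _ (ray 0)).
have [a ca] : exists a, codes a track.
  by apply: exists_codes; rewrite /track; cauto.
have [h hP] := choice (fun i => exists_codes (cfun_cst set0 (hub i))).
pose hubs := foldr pr 0 (mkseq h 3).
have ch i : i < 3 -> codes (entry hubs i) (fun=> hub i).
  by move=> i3; rewrite /hubs entry_foldr nth_mkseq.
apply: (computes_of_enumerations
  (P := fun e z => marked hubs r a (pr e (pr1 z).+1) (pr2 z))
  (N := fun e z => marked hubs r a (pr e 0) z)).
- by apply: cpred_marked; cauto.
- by apply: cpred_marked; cauto.
- move=> e; rewrite double_jumpP.
  split=> [[k /(markedP _ ch cr ca)[z hz]]|[z hz]].
    by exists (pr k z); rewrite pr1E pr2E.
  by exists (pr1 z); apply/(markedP _ ch cr ca); exists (pr2 z).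
- by move=> e; rewrite double_jumpNP markedP.
Qed.

End Presented.

Theorem theorem3p3 :
  exists G : graph nat,
    computable (diagram G) /\
    forall (C : set nat) (hC : cohesive C) (A : graph nat),
      presentation (cohesive_power G hC) A ->
      computes (diagram A) (jump (jump set0)).
Proof.
exists coding_graph; split; first exact: coding_graph_computable.
move=> C hC A [f [f_bij f_edge]].
exact: (presented_computes hC f_bij f_edge).
Qed.
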